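(* Let $d\in\{1,2,3,7,11\}$, $K=\mathbb{Q}(\sqrt{-d})$, $\mathcal{O}_d$ its ring of integers, let $\Delta$ be a positive integer which is not of the form $\beta\bar\beta$ with $\beta\in\mathcal{O}_d$, and let $k\ge1$ be an odd integer. Then the series $$H_{k,\Delta}(z)=\sum_{\substack{(a,b,c)\in\mathbb{Z}\times\mathcal{O}_d\times\mathbb{Z}\\ b\bar b-ac=\Delta,\ a<0}}\max\left(0,\left(a|z|^2+bz+\bar b\bar z+c\right)^k\right)$$ converges for every $z\in\mathbb{C}$ and $H_{k,\Delta}$ is a continuous function on $\mathbb{C}$. *)

(* Defs.v *)
From HB Require Import structures.
From mathcomp Require Import all_boot all_order all_algebra.
From mathcomp Require Import all_classical all_reals all_analysis.
From mathcomp Require Import complex.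
Unset Printing Implicit Defensive.
Import Order.TTheory GRing.Theory Num.Theory.
Import numFieldNormedType.Exports.
Local Open Scope ring_scope.
Local Open Scope classical_set_scope.
Local Open Scope complex_scope.

(* Generator of the ring of integers O_d of Q(sqrt(-d)) (d squarefree, d > 0):
   omega = sqrt(-d) if d <> 3 mod 4, and (1 + sqrt(-d))/2 if d = 3 mod 4. *)
Definition omega_d (R : realType) (d : nat) : R[i] :=
  if (d %% 4 == 3)%N then (1 + 'i * (Num.sqrt (d%:R : R))%:C) / 2
  else 'i * (Num.sqrt (d%:R : R))%:C.

Definition Od (R : realType) (d : nat) : set R[i] :=
  [set b | exists m n : int, b = m%:~R + n%:~R * omega_d R d].

Definition Hindex (R : realType) (d Delta : nat) : set (int * R[i] * int) :=
  [set t | Od R d t.1.2 /\ t.1.2 * conjc t.1.2 - (t.1.1 * t.2)%:~R = Delta%:R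
           /\ t.1.1 < 0].

(* The real number a|z|^2 + b z + conj(b) conj(z) + c (real part of a real complex number). *)
Definition Qform (R : realType) (t : int * R[i] * int) (z : R[i]) : R :=
  complex.Re (t.1.1%:~R * (z * conjc z) + t.1.2 * z + conjc t.1.2 * conjc z + t.2%:~R).

Definition Hterm (R : realType) (k : nat) (t : int * R[i] * int) (z : R[i]) : R :=
  Num.max 0 (Qform R t z ^+ k).

Definition H (R : realType) (d Delta k : nat) (z : R[i]) : R :=
  fine (\esum_(t in Hindex R d Delta) (Hterm R k t z)%:E)%E.

(* Main.v *)
Require Import Defs.
From HB Require Import structures.
From mathcomp Require Import all_boot all_order all_algebra.
From mathcomp Require Import all_classical all_reals all_analysis.
From mathcomp Require Import complex finmap ring lra zify.
Import Order.TTheory GRing.Theory Num.Theory.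
Import numFieldNormedType.Exports.
Local Open Scope ring_scope.
Local Open Scope classical_set_scope.

(** For a form [t = (a, b, c)] with [a < 0] one has
    [Q_t(z) = (Delta - |a z + conj b|^2) / |a|], so every term is at most
    [Delta ^ k].  Two symmetries drive the proof: translating [z] by an element
    of the lattice permutes the forms and keeps [a]; and
    [Q_(a,b,c)(z) = |z|^2 Q_(c,b,a)(z / |z|^2)].  Since the field is Euclidean,
    every [z] can be translated into the disc [|z|^2 <= 15/16].  There, a form
    with [Q_t(z) > 0] either lies in a fixed finite set or has [a < c < 0], in
    which case the inversion trades it for a form with smaller [|a|], at the
    cost of a factor [|z|^(2k) <= 15/16].  Induction on [|a|] then bounds all
    finite subsums by the constant [M] with [M = B + (15/16) M], where [B] bounds
    the contribution of the finite set.

    For continuity, write [H = Hpos + Hneg] according to the sign of [c], which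
    is nonzero because [Delta] is not a norm.  [Hpos] is a finite sum, and
    [Hneg(z) = |z|^(2k) Hneg(z / |z|^2)].  Hence if the oscillation of [H] is at
    most [eta] at every point, it is at most [(15/16) eta + e] at every point
    for every [e > 0]; it starts at most [M], so it vanishes. *)

(** * Real coordinates of the forms and of the generator of the ring *)

Lemma intr_complex (R : realType) (m : int) :
  m%:~R = Complex m%:~R 0 :> R[i].
Proof. by rewrite -(rmorph_int (real_complex R)). Qed.

Lemma natr_complex (R : realType) (n : nat) :
  n%:R = Complex n%:R 0 :> R[i].
Proof. by rewrite -(rmorph_nat (real_complex R)). Qed.

Lemma QformE (R : realType) (a c : int) (b z : R[i]) :
  Qform R (a, b, c) z = a%:~R * (complex.Re z ^+ 2 + complex.Im z ^+ 2)
    + 2 * (complex.Re b * complex.Re z - complex.Im b * complex.Im z) + c%:~R.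
Proof.
case: b z => [b1 b2] [x y]; rewrite /Qform !intr_complex /=; ring.
Qed.

Lemma mulcJE (R : realType) (b : R[i]) :
  b * conjc b = Complex (complex.Re b ^+ 2 + complex.Im b ^+ 2) 0.
Proof. by case: b => b1 b2; simpc; congr Complex => /=; ring. Qed.

Lemma HindexE (R : realType) (d Delta : nat) (a c : int) (b : R[i]) :
  Hindex R d Delta (a, b, c) <->
  [/\ Od R d b, complex.Re b ^+ 2 + complex.Im b ^+ 2 - a%:~R * c%:~R = Delta%:R :> R & a < 0].
Proof.
rewrite /Hindex /= mulcJE intr_complex natr_complex intrM.
split; first by move=> [hb [[h _] ha]]; split.
by move=> [hb h ha]; split=> //; split=> //; simpc; rewrite h.
Qed.

(** [T] and [q] are the trace and the norm of the generator, so that the five fields are treated at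
    once. The bound [11 / 4] is attained at [d = 11] and carries the Euclidean property. *)
Lemma omega_dP (R : realType) (d : nat) : d \in [:: 1; 2; 3; 7; 11]%N ->
  exists T q : int, exists s : R,
  [/\ omega_d R d = Complex (T%:~R / 2) s,
      s ^+ 2 + (T%:~R / 2) ^+ 2 = q%:~R, 0 < s & s ^+ 2 <= 11 / 4].
Proof.
have D0 n : (0 < n)%N -> 0 < Num.sqrt n%:R :> R.
  by move=> n0; rewrite sqrtr_gt0 ltr0n.
have DD n : Num.sqrt n%:R ^+ 2 = n%:R :> R by rewrite sqr_sqrtr ?ler0n.
have E1 n : n \in [:: 1; 2]%N -> omega_d R n = Complex 0 (Num.sqrt n%:R).
  by rewrite !inE => /orP[]/eqP->; rewrite /omega_d /=; simpc.
have E2 n : n \in [:: 3; 7; 11]%N ->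
    omega_d R n = Complex (1 / 2) (Num.sqrt n%:R / 2).
  have h : (2 : R[i])^-1 = Complex 2^-1 0.
    by rewrite natr_complex -(fmorphV (real_complex R)).
  rewrite !inE => /or3P[]/eqP->; rewrite /omega_d /= h; simpc;
  by congr Complex => /=; ring.
rewrite !inE => /or4P[|||/orP[]] /eqP->.
- exists 0, 1, (Num.sqrt 1%:R); rewrite E1// D0// DD mul0r.
  by split=> //; lra.
- exists 0, 2, (Num.sqrt 2%:R); rewrite E1// D0// DD mul0r.
  by split=> //; lra.
- exists 1, 1, (Num.sqrt 3%:R / 2); rewrite E2// expr_div_n DD.
  by have := D0 3%N isT => ?; split=> //; lra.
- exists 1, 2, (Num.sqrt 7%:R / 2); rewrite E2// expr_div_n DD.
  by have := D0 7%N isT => ?; split=> //; lra.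
- exists 1, 3, (Num.sqrt 11%:R / 2); rewrite E2// expr_div_n DD.
  by have := D0 11%N isT => ?; split=> //; lra.
Qed.

Lemma nearest_int (R : realType) (x : R) :
  exists m : int, (x - m%:~R) ^+ 2 <= 1 / 4.
Proof.
exists (Num.floor (x + 1 / 2)).
have /andP[] := floor_itv (x + 1 / 2); rewrite intrD => h1 h2.
set f := (Num.floor _)%:~R in h1 h2 *; nra.
Qed.

Lemma finite_int_le (R : realType) (K : R) :
  finite_set [set m : int | `|m%:~R| <= K].
Proof.
pose N := (Num.trunc K).+1.
apply: (@sub_finite_set _ _ ((fun i : nat => i%:Z - N%:Z) @` `I_(N + N).+1)).
  move=> m /= hm.
  have : `|m| <= N.
    have /le_lt_trans : `|m%:~R : R| <= K := hm.
    move=> /(_ _ (truncnS_gt K)); rewrite -intr_norm => h; apply: ltW.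
    by move: h; rewrite -[_.+1%:R]/(N%:~R) ltr_int.
  move=> hN; exists (absz (m + N%:Z)) => /=; lia.
exact/finite_image/finite_II.
Qed.

(** * The ring of integers as a lattice in the plane *)

Section Lattice.
Context {R : realType} {d : nat} {T nu : int} {s : R}.
Hypothesis omegaE : omega_d R d = Complex (T%:~R / 2) s.
Hypothesis omega_norm : s ^+ 2 + (T%:~R / 2) ^+ 2 = nu%:~R.
Hypothesis s_gt0 : 0 < s.
Hypothesis s_le : s ^+ 2 <= 11 / 4.

Lemma OdP (b : R[i]) : Od R d b <-> exists m n : int,
  b = Complex (m%:~R + n%:~R * (T%:~R / 2)) (n%:~R * s).
Proof.
have E m n : (m%:~R + n%:~R * omega_d R d) =
    Complex (m%:~R + n%:~R * (T%:~R / 2)) (n%:~R * s).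
  by rewrite omegaE !intr_complex; simpc.
by split=> -[m [n ->]]; exists m, n; rewrite E.
Qed.

Lemma Od_addM (b mu : R[i]) (a : int) :
  Od R d b -> Od R d mu -> Od R d (b + a%:~R * mu).
Proof.
move=> [m [n ->]] [m' [n' ->]]; exists (m + a * m'), (n + a * n').
by rewrite !intrD !intrM; ring.
Qed.

(** This is the trace of [b * conjc mu]; it expands to an integer because the trace [T] and the norm
    [nu] of the generator are integers. *)
Lemma Od_dot_int (b mu : R[i]) : Od R d b -> Od R d mu ->
  2 * (complex.Re b * complex.Re mu + complex.Im b * complex.Im mu) \is a Num.int.
Proof.
move=> /OdP[m [n ->]] /OdP[m' [n' ->]] /=.
apply/intrP; exists (2 * m * m' + T * (m * n' + m' * n) + 2 * n * n' * nu).
by rewrite !(intrD, intrM) -omega_norm; field.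
Qed.

Lemma Od_norm_int (b : R[i]) : Od R d b ->
  complex.Re b ^+ 2 + complex.Im b ^+ 2 \is a Num.int.
Proof.
move=> /OdP[m [n ->]] /=.
apply/intrP; exists (m * m + T * m * n + n * n * nu).
by rewrite !(intrD, intrM) -omega_norm; field.
Qed.

Lemma Od_near (z : R[i]) : exists2 mu, Od R d mu &
  (complex.Re z - complex.Re mu) ^+ 2 + (complex.Im z + complex.Im mu) ^+ 2
  <= 15 / 16.
Proof.
(* [n] comes first, since the real part of the lattice point depends on it. The squared errors are
   at most [1/4] and [s^2 / 4 <= 11/16], which add up to [15/16]. The signs make this the distance
   from [z] to [conjc mu]. *)
have [n hn] := nearest_int R (- complex.Im z / s).
have [m hm] := nearest_int R (complex.Re z - n%:~R * (T%:~R / 2)).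
exists (Complex (m%:~R + n%:~R * (T%:~R / 2)) (n%:~R * s)).
  by apply/OdP; exists m, n.
rewrite /=.
have -> : complex.Im z + n%:~R * s = - s * (- complex.Im z / s - n%:~R).
  by field; rewrite gt_eqF.
have -> : complex.Re z - (m%:~R + n%:~R * (T%:~R / 2)) =
    complex.Re z - n%:~R * (T%:~R / 2) - m%:~R by ring.
rewrite exprMn sqrrN.
have : s ^+ 2 * (- complex.Im z / s - n%:~R) ^+ 2 <= 11 / 4 * (1 / 4).
  by apply: ler_pM => //; exact: sqr_ge0.
lra.
Qed.

Lemma finite_Od_box (K : R) : finite_set [set t : int * R[i] * int |
  [/\ Od R d t.1.2, `|t.1.1%:~R| <= K,
      complex.Re t.1.2 ^+ 2 + complex.Im t.1.2 ^+ 2 <= K & `|t.2%:~R| <= K]].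
Proof.
pose L := K + 1 + `|T%:~R / 2| * (K / s ^+ 2) + K / s ^+ 2.
pose f (u : (int * int) * (int * int)) := (u.1.1,
  Complex (u.2.1%:~R + u.2.2%:~R * (T%:~R / 2)) (u.2.2%:~R * s), u.1.2).
have fin := finite_int_le R L.
apply: sub_finite_set (finite_image f (finite_setX (finite_setX fin fin)
  (finite_setX fin fin))).
move=> [[a b] c] /= [/OdP[m [n ->]] ha + hc] /=.
set u := m%:~R + _ => hb.
have K0 : 0 <= K by rewrite (le_trans _ ha).
have s2 : 0 < s ^+ 2 by rewrite exprn_gt0.
have Ks : 0 <= K / s ^+ 2 by rewrite divr_ge0// ltW.
have TK : 0 <= `|T%:~R / 2| * (K / s ^+ 2) by rewrite mulr_ge0.
(* Integers satisfy [|n| <= n^2], so no square root is needed. *)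
have hn : `|n%:~R| <= K / s ^+ 2.
  rewrite ler_pdivlMr//; apply: (@le_trans _ _ ((n%:~R * s) ^+ 2)); last first.
    by rewrite (le_trans _ hb)// lerDr sqr_ge0.
  rewrite exprMn ler_pM2r// -[leRHS]ger0_norm ?sqr_ge0// normrX.
  rewrite -intr_norm -rmorphXn/= ler_int; nia.
have hu : `|u| <= K + 1.
  have : `|u| ^+ 2 <= K.
    by rewrite real_normK ?num_real// (le_trans _ hb)// lerDl sqr_ge0.
  have := normr_ge0 u; nra.
have hm : `|m%:~R| <= K + 1 + `|T%:~R / 2| * (K / s ^+ 2).
  have -> : m%:~R = u - n%:~R * (T%:~R / 2) by rewrite /u addrK.
  rewrite (le_trans (ler_normB _ _))// lerD// normrM mulrC.
  by rewrite ler_wpM2l.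
exists ((a, c), (m, n)) => //; split; split=> /=; rewrite /L; lra.
Qed.

End Lattice.

(** * Inversion and translation acting on points and forms *)

Definition sqmod (R : realType) (z : R[i]) : R :=
  complex.Re z ^+ 2 + complex.Im z ^+ 2.

(** Inversion in the unit circle, [1 / conjc z]; division by zero sends [0] to [0]. *)
Definition cinv (R : realType) (z : R[i]) : R[i] :=
  Complex (complex.Re z / sqmod R z) (complex.Im z / sqmod R z).

Definition flip (R : realType) (t : int * R[i] * int) : int * R[i] * int :=
  (t.2, t.1.2, t.1.1).

(* On the forms of the family the floor is taken of an integer. *)
Definition translate (R : realType) (mu : R[i]) (t : int * R[i] * int) :
    int * R[i] * int :=
  (t.1.1, t.1.2 + t.1.1%:~R * mu,
   t.2 + Num.floor (t.1.1%:~R * sqmod R mu +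
     2 * (complex.Re t.1.2 * complex.Re mu + complex.Im t.1.2 * complex.Im mu))).

Lemma sqmod_ge0 (R : realType) (z : R[i]) : 0 <= sqmod R z.
Proof. by rewrite addr_ge0// sqr_ge0. Qed.

Lemma sqmod_eq0 (R : realType) (z : R[i]) : sqmod R z = 0 -> z = 0.
Proof.
case: z => x y /eqP; rewrite /sqmod /= paddr_eq0 ?sqr_ge0// !sqrf_eq0.
by move=> /andP[/eqP-> /eqP->].
Qed.

Lemma Hterm_ge0 (R : realType) (k : nat) t (z : R[i]) : 0 <= Hterm R k t z.
Proof. by rewrite /Hterm le_max lexx. Qed.

Lemma Hterm_le0 (R : realType) (k : nat) t (z : R[i]) : odd k ->
  Qform R t z <= 0 -> Hterm R k t z = 0.
Proof. by move=> hk q0; rewrite /Hterm max_l// exprn_odd_le0. Qed.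

Lemma Qform_flip (R : realType) t (z : R[i]) : sqmod R z != 0 ->
  Qform R t z = sqmod R z * Qform R (flip R t) (cinv R z).
Proof.
case: t => [[a b] c] z0; rewrite /flip !QformE /= {1}/sqmod.
rewrite !expr_div_n -mulrDl -/(sqmod R z).
by field.
Qed.

(* At [z = 0] both sides vanish when the constant coefficient is negative. *)
Lemma Hterm_flip (R : realType) (k : nat) t (z : R[i]) : odd k -> t.2 < 0 ->
  Hterm R k t z = sqmod R z ^+ k * Hterm R k (flip R t) (cinv R z).
Proof.
move=> hk c0; have [z0|z0] := eqVneq (sqmod R z) 0.
  rewrite z0 expr0n; case: k hk => //= k hk; rewrite mul0r Hterm_le0//.
  rewrite (sqmod_eq0 _ _ z0); case: t c0 => [[a b] c] /= c0.
  by rewrite QformE /= !expr0n /= !mulr0 subrr mulr0 !addr0 mulr0 add0r lerz0 ltW.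
rewrite /Hterm Qform_flip// exprMn.
by rewrite maxr_pMr ?mulr0 ?exprn_ge0// sqmod_ge0.
Qed.

Lemma Re_intrM (R : realType) (a : int) (mu : R[i]) :
  complex.Re (a%:~R * mu) = a%:~R * complex.Re mu.
Proof. by rewrite intr_complex; case: mu => u v /=; ring. Qed.

Lemma Im_intrM (R : realType) (a : int) (mu : R[i]) :
  complex.Im (a%:~R * mu) = a%:~R * complex.Im mu.
Proof. by rewrite intr_complex; case: mu => u v /=; ring. Qed.

Lemma flipK (R : realType) t : flip R (flip R t) = t.
Proof. by case: t => [[]]. Qed.

Lemma esum_pZl (R : realType) (I : choiceType) (D : set I) (x : R) (f : I -> \bar R) :
  0 <= x -> (forall i, (0 <= f i)%E) ->
  (\esum_(i in D) (x%:E * f i) = x%:E * \esum_(i in D) f i)%E.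
Proof.
move=> x0 f0; rewrite /esum -ereal_supZl//; last first.
  by apply/set0P; eexists; exists set0 => //; exact: fsets_set0.
congr ereal_sup; rewrite image_comp; apply: eq_imagel => A _ /=.
by rewrite ge0_mule_fsumr.
Qed.

(** * Continuity of single terms and of the inversion *)

Definition plane (R : realType) (p : R * R) : R[i] := Complex p.1 p.2.

Lemma continuous_sqmod (R : realType) : continuous (sqmod R \o plane R).
Proof.
move=> p; rewrite /comp /sqmod /plane /=.
by apply: cvgD; apply: cvgM; (exact: cvg_fst || exact: cvg_snd).
Qed.

Lemma continuous_Hterm (R : realType) (k : nat) t :
  continuous (Hterm R k t \o plane R).
Proof.
case: t => [[a b] c] p.
pose f (q : R * R) : R := a%:~R * (sqmod R \o plane R) q
    + 2 * (complex.Re b * q.1 - complex.Im b * q.2) + c%:~R.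
have -> : Hterm R k (a, b, c) \o plane R = (cst 0) \max (fun q => f q ^+ k).
  by apply/funext => q; rewrite /comp /Hterm QformE.
apply: (@continuous_max _ _ (cst 0) (fun q => f q ^+ k)).
  exact: cst_continuous.
apply: (@continuous_comp _ _ _ f (fun x => x ^+ k)); last exact: exprn_continuous.
apply: cvgD; last exact: cvg_cst.
apply: cvgD; first by apply: cvgMr; exact: continuous_sqmod.
by apply: cvgMr; apply: cvgB; apply: cvgMr; [exact: cvg_fst|exact: cvg_snd].
Qed.

Lemma continuous_cinv (R : realType) (p : R * R) : sqmod R (plane R p) != 0 ->
  {for p, continuous (fun q : R * R =>
    (q.1 / sqmod R (plane R q), q.2 / sqmod R (plane R q)))}.
Proof.
move=> p0; have h := continuous_sqmod R p.
have h1 : (fun q : R * R => q.1 / sqmod R (plane R q)) @ p -->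
    p.1 / sqmod R (plane R p).
  by apply: cvgM; [exact: cvg_fst|exact: cvgV].
have h2 : (fun q : R * R => q.2 / sqmod R (plane R q)) @ p -->
    p.2 / sqmod R (plane R p).
  by apply: cvgM; [exact: cvg_snd|exact: cvgV].
exact: cvg_pair h1 h2.
Qed.

(** * Size estimates for the forms of the family *)

Section Forms.
Context {R : realType} {d Delta : nat}.
Hypothesis not_norm :
  ~ exists beta : R[i], Od R d beta /\ beta * conjc beta = Delta%:R.

Let hindex := Hindex R d Delta.

Lemma Hindex_flip t : hindex t -> t.2 < 0 -> hindex (flip R t).
Proof.
case: t => [[a b] c] /HindexE[hb hD ha] /= hc; apply/HindexE; split=> //.
by rewrite mulrC.
Qed.

(** With [c = 0] the discriminant equation would make [Delta] the norm of [b]. *)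
Lemma Hindex_c_neq0 t : hindex t -> t.2 != 0.
Proof.
case: t => [[a b] c] /HindexE[hb hD _] /=; apply/eqP => c0; apply: not_norm.
exists b; split=> //; rewrite mulcJE natr_complex; congr Complex.
by rewrite -hD c0 mulr0 subr0.
Qed.

Lemma Qform_square a b c (z : R[i]) : hindex (a, b, c) ->
  a%:~R * Qform R (a, b, c) z = (a%:~R * complex.Re z + complex.Re b) ^+ 2
    + (a%:~R * complex.Im z - complex.Im b) ^+ 2 - Delta%:R.
Proof. by move=> /HindexE[_ <- _]; rewrite QformE; ring. Qed.

Lemma Hindex_a_le a b c : hindex (a, b, c) -> a%:~R <= -1 :> R.
Proof.
move=> /HindexE[_ _ a0]; rewrite -[-1]/((-1)%:~R) ler_int.
by lia.
Qed.

Lemma Qform_le t (z : R[i]) : hindex t -> Qform R t z <= Delta%:R.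
Proof.
case: t => [[a b] c] ht; have := Qform_square _ _ _ z ht.
have a1 := Hindex_a_le _ _ _ ht; have D0 : 0 <= Delta%:R :> R by [].
set u := (_ ^+ 2); set v := (_ ^+ 2); set Q := Qform _ _ _ => E.
have u0 : 0 <= u := sqr_ge0 _; have v0 : 0 <= v := sqr_ge0 _.
by have [Q0|/ltW Q0] := leP Q 0; [exact: le_trans D0|nra].
Qed.

Lemma Hterm_le (k : nat) t (z : R[i]) : odd k -> hindex t ->
  Hterm R k t z <= Delta%:R ^+ k.
Proof.
move=> hk ht; have [Q0|Q0] := leP (Qform R t z) 0.
  by rewrite Hterm_le0// exprn_ge0.
rewrite /Hterm ge_max exprn_ge0//= lerXn2r ?nnegrE// ?(ltW Q0)//.
exact: Qform_le.
Qed.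

(* [|a| > 960 Delta] is what makes [30 Delta + (31/32) a^2 < a^2] below. *)
Definition box_radius : R :=
  32 * Delta%:R + (960 * Delta%:R) ^+ 2 + 960 * Delta%:R.

Definition box : set (int * R[i] * int) := [set t |
  [/\ Od R d t.1.2, `|t.1.1%:~R| <= box_radius,
      complex.Re t.1.2 ^+ 2 + complex.Im t.1.2 ^+ 2 <= box_radius
    & `|t.2%:~R| <= box_radius]].

Lemma Hindex_pos_box t : hindex t -> 0 < t.2 -> box t.
Proof.
case: t => [[a b] c] ht cpos.
have [hb hD _] : [/\ Od R d b, complex.Re b ^+ 2 + complex.Im b ^+ 2
   - a%:~R * c%:~R = Delta%:R :> R & a < 0] by apply/HindexE.
have a1 := Hindex_a_le _ _ _ ht.
have c1 : 1 <= c%:~R :> R by rewrite -[1]/(1%:~R) ler_int.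
(* Expanded, this is [|a| + c <= |a| c + 1], while [|b|^2 + |a| c = Delta]. *)
have AC : 0 <= (- a%:~R - 1) * (c%:~R - 1) :> R by rewrite mulr_ge0//; lra.
have b10 := sqr_ge0 (complex.Re b); have b20 := sqr_ge0 (complex.Im b).
have D20 := sqr_ge0 (960 * Delta%:R : R).
have D0 : 0 <= Delta%:R :> R by [].
by split=> //=; rewrite /box_radius ?ler_norml; lra.
Qed.

(** Positivity gives [|a z + conj b|^2 < Delta], so [b] is close to [- a conj z] and [|b|^2] is at
    most [31 Delta + (31/32) a^2], where [31/32 = (31/30) (15/16)]. For [|a| > 960 Delta] this
    forces [a c = |b|^2 - Delta < a^2], and for smaller [|a|] the form is in the box. *)
Lemma Hindex_box_or_descend t (z : R[i]) : hindex t -> sqmod R z <= 15 / 16 ->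
  0 < Qform R t z -> ~ box t -> t.2 < 0 /\ t.1.1 < t.2.
Proof.
case: t => [[a b] c] ht hz hQ nbox.
have c0 : c < 0.
  rewrite lt_neqAle (Hindex_c_neq0 _ ht)/= leNgt; apply/negP => cpos.
  exact/nbox/Hindex_pos_box.
have a1 := Hindex_a_le _ _ _ ht.
have hsq := Qform_square _ _ _ z ht.
have [hb hD _] : [/\ Od R d b, complex.Re b ^+ 2 + complex.Im b ^+ 2
   - a%:~R * c%:~R = Delta%:R :> R & a < 0] by apply/HindexE.
rewrite /=.
move: hz hQ hsq; rewrite /sqmod; case: z => x y /=.
move: (Qform _ _ _) => Q hz hQ hsq.
move: nbox; rewrite /box /= /box_radius.
move: hb hD hsq; case: b {ht} => b1 b2 /= hb hD hsq nbox.
have D0 : 0 <= Delta%:R :> R by [].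
move: hD hsq nbox D0; move: (Delta%:R : R) => D hD hsq nbox D0.
rewrite -(ltrz0 R c) -(ltr_int R a c).
have c1 : c%:~R <= -1 :> R by rewrite -[-1]/((-1)%:~R) ler_int; lia.
move: a1 c1 nbox hD hsq.
move: (a%:~R : R) (c%:~R : R) => A C a1 c1 nbox hD hsq {c0}.
have AQ : A * Q < 0 by rewrite nmulr_rlt0//; lra.
pose u := A * x + b1; pose v := A * y - b2.
have uv : u ^+ 2 + v ^+ 2 < D by rewrite /u /v; lra.
(* [|u - w|^2 <= 31 |u|^2 + 31/30 |w|^2] with [u = a z + conj b], [w = a z]. *)
have hb2 : b1 ^+ 2 + b2 ^+ 2 <= 31 * D + 31 / 32 * A ^+ 2.
  have e1 : 0 <= (30 * u + A * x) ^+ 2 by exact: sqr_ge0.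
  have e2 : 0 <= (30 * v + A * y) ^+ 2 by exact: sqr_ge0.
  have e3 : A ^+ 2 * (x ^+ 2 + y ^+ 2) <= A ^+ 2 * (15 / 16).
    by rewrite ler_wpM2l// sqr_ge0.
  have -> : b1 = u - A * x by rewrite /u; ring.
  have -> : b2 = A * y - v by rewrite /v; ring.
  nra.
have [hA|hA] := leP (- A) (960 * D).
  exfalso; apply: nbox.
  have A2 : A ^+ 2 <= (960 * D) ^+ 2 by rewrite -sqrrN lerXn2r ?nnegrE; lra.
  have A20 : 0 <= A ^+ 2 := sqr_ge0 A.
  (* [|c| <= a c = |b|^2 - Delta], so the bounds on [a] and [b] also bound [c]. *)
  have AC : - C <= A * C by nra.
  split=> //; rewrite ?ler_norml; lra.
split; first lra.
have : A * C < A * A by nra.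
by rewrite ltr_nM2l//; lra.
Qed.

End Forms.

(** * Lattice translations of the family and reduction of points to the disc *)

Section Family.
Context {R : realType} {d : nat} {T nu : int} {s : R}.
Hypothesis omegaE : omega_d R d = Complex (T%:~R / 2) s.
Hypothesis omega_norm : s ^+ 2 + (T%:~R / 2) ^+ 2 = nu%:~R.
Hypothesis s_gt0 : 0 < s.
Hypothesis s_le : s ^+ 2 <= 11 / 4.
Context {Delta k : nat}.
Hypothesis hk : odd k.
Hypothesis not_norm :
  ~ exists beta : R[i], Od R d beta /\ beta * conjc beta = Delta%:R.

Let hindex := Hindex R d Delta.
Let box := @box R d Delta.

Lemma translate_floor t mu : hindex t -> Od R d mu ->
  (Num.floor (t.1.1%:~R * sqmod R mu +
     2 * (complex.Re t.1.2 * complex.Re mu + complex.Im t.1.2 * complex.Im mu)))%:~R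
  = t.1.1%:~R * sqmod R mu +
     2 * (complex.Re t.1.2 * complex.Re mu + complex.Im t.1.2 * complex.Im mu) :> R.
Proof.
case: t => [[a b] c] /HindexE[hb _ _] hmu /=.
apply/floorK; rewrite rpredD//.
  by rewrite rpredM ?intr_int// (Od_norm_int omegaE omega_norm).
exact: (Od_dot_int omegaE omega_norm).
Qed.

(** The conjugate comes from [a (z + conj mu) + conj b = a z + conj (b + a mu)]. *)
Lemma Qform_translate t mu z : hindex t -> Od R d mu ->
  Qform R (translate R mu t) z = Qform R t (z + conjc mu).
Proof.
move=> ht hmu; have := translate_floor _ _ ht hmu.
case: t ht => [[a b] c] ht /= E; rewrite /translate /= !QformE !raddfD /= E.
rewrite Re_intrM Im_intrM /sqmod; case: mu {hmu E} => u v /=.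
by case: z => x y /=; ring.
Qed.

Lemma Hindex_translate t mu : hindex t -> Od R d mu -> hindex (translate R mu t).
Proof.
move=> ht hmu; have := translate_floor _ _ ht hmu.
case: t ht => [[a b] c] /= /HindexE[hb hD ha] E; apply/HindexE; split=> //.
  exact: Od_addM.
rewrite intrD E -hD !raddfD /= Re_intrM Im_intrM /sqmod; ring.
Qed.

Lemma translate_opp t mu : hindex t -> Od R d mu ->
  translate R (- mu) (translate R mu t) = t.
Proof.
move=> ht hmu; have := translate_floor _ _ ht hmu.
case: t ht => [[a b] c] ht /= E; rewrite /translate /=; congr (_, _, _).
  by rewrite mulrN addrK.
set x := Num.floor _ in E *; set y := _ + 2 * _.
(* Replacing [b] by [b + a mu] and [mu] by [- mu] turns [a |mu|^2 + 2 Re (b conj mu)] into its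
   opposite. *)
suff -> : y = (- x)%:~R by rewrite intrKfloor addrK.
rewrite /y intrN E !raddfD /= Re_intrM Im_intrM /sqmod.
by case: mu {hmu E x y} => u v /=; ring.
Qed.

Lemma finite_box : finite_set box.
Proof. exact: (finite_Od_box omegaE s_gt0). Qed.

Lemma reduce_point (z : R[i]) : exists2 mu, Od R d mu &
  exists2 z', sqmod R z' <= 15 / 16 & z = z' + conjc mu.
Proof.
have [mu hmu h] := Od_near omegaE s_gt0 s_le z.
exists mu => //; exists (z - conjc mu); last by rewrite subrK.
by move: h; case: z mu {hmu} => x y [u v]; rewrite /sqmod /= opprK.
Qed.

(** * Uniform bound on finite subsums, and convergence *)

Lemma exprn_contract (x : R) : 0 <= x <= 15 / 16 -> x ^+ k <= 15 / 16.
Proof.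
(* Oddness excludes [k = 0], so [x ^+ k <= x] on the unit interval. *)
case: k hk => // n _ /andP[x0 x1]; rewrite exprSr.
rewrite (le_trans _ x1)// ler_piMl// exprn_ile1//; lra.
Qed.

(** The solution [M = 16 B] of [M = B + (15/16) M], where [B] allows [Delta ^ k] for each element of
    the box. *)
Definition Hbound : R := 16 * (Delta%:R ^+ k *+ #|` fset_set box|%fset).

Lemma Hbound_ge0 : 0 <= Hbound.
Proof. by rewrite mulr_ge0// mulrn_wge0// exprn_ge0. Qed.

(* A term that does not lie in the box is carried by [flip] to one with a
   smaller leading coefficient, at the cost of a factor [15 / 16]. *)
Lemma Hterm_sum_le (N : nat) (r : seq (int * R[i] * int)) (z : R[i]) :
  uniq r -> (forall t, t \in r -> hindex t /\ - (N%:Z) <= t.1.1) ->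
  \sum_(t <- r) Hterm R k t z <= Hbound.
Proof.
elim: N r z => [|N IH] r z ur hr.
  rewrite big_seq big1 ?Hbound_ge0// => -[[a b] c] /hr[/HindexE[_ _ a0] /=]; lia.
(* Translation keeps leading coefficients, so the hypotheses on [r] survive the passage to the
   disc. *)
have [mu hmu [z' hz' ->]] := reduce_point z.
have -> : \sum_(t <- r) Hterm R k t (z' + conjc mu) =
          \sum_(t <- map (translate R mu) r) Hterm R k t z'.
  rewrite big_map big_seq [RHS]big_seq; apply: eq_bigr => t /hr[ht _].
  by rewrite /Hterm (Qform_translate _ _ _ ht hmu).
have : uniq (map (translate R mu) r).
  rewrite map_inj_in_uniq// => t t' /hr[ht _] /hr[ht' _] E.
  by rewrite -(translate_opp _ _ ht hmu) E translate_opp.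
have : forall t, t \in map (translate R mu) r -> hindex t /\ - N.+1%:Z <= t.1.1.
  by move=> _ /mapP[t /hr[ht ha] ->]; split=> //; exact: Hindex_translate.
move: (map _ r) => {ur hr}r hr ur {hmu mu}.
rewrite (bigID (fun t => t \in box))/=.
have h1 : \sum_(t <- r | t \in box) Hterm R k t z' <= Hbound / 16.
  apply: (@le_trans _ _ (\sum_(t <- r | t \in box) Delta%:R ^+ k)).
    rewrite big_seq_cond [leRHS]big_seq_cond.
    by apply: ler_sum => t /andP[/hr[ht _] _]; exact: (Hterm_le _ _ _ hk ht).
  rewrite big_const_seq iter_addr_0 /Hbound mulrAC divff// mul1r.
  apply: ler_wpMn2l; first exact: exprn_ge0.
  rewrite -size_filter; apply: uniq_leq_size; first exact: filter_uniq.
  by move=> t; rewrite mem_filter (in_fset_set finite_box) => /andP[].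
pose P (t : int * R[i] * int) := (t.2 < 0) && (t.1.1 < t.2).
have h2 : \sum_(t <- r | t \notin box) Hterm R k t z' <= 15 / 16 * Hbound.
  (* Outside the box a term is zero unless its form satisfies [P]. *)
  apply: (@le_trans _ _ (\sum_(t <- r | P t) Hterm R k t z')).
    rewrite [leLHS]big_mkcond [leRHS]big_mkcond big_seq [leRHS]big_seq.
    apply: ler_sum => t /hr[ht _]; case: ifPn => [tbox|_]; last first.
      by case: ifP => // _; exact: Hterm_ge0.
    have [Q0|Q0] := leP (Qform R t z') 0.
      by rewrite Hterm_le0//; case: ifP.
    case: (Hindex_box_or_descend not_norm t z' ht hz' Q0).
      by move: tbox; rewrite notin_setE.
    by rewrite /P => -> ->.
  have -> : \sum_(t <- r | P t) Hterm R k t z' = sqmod R z' ^+ k *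
      \sum_(t <- map (flip R) [seq t <- r | P t]) Hterm R k t (cinv R z').
    rewrite big_map big_filter mulr_sumr; apply: eq_bigr => t /andP[c0 _].
    exact: Hterm_flip.
  rewrite ler_pM ?exprn_ge0 ?sqmod_ge0//.
  - by apply: sumr_ge0 => t _; exact: Hterm_ge0.
  - by rewrite exprn_contract// sqmod_ge0.
  (* [cinv z'] is in general outside the disc, hence an induction hypothesis valid at every point.
     The new leading coefficient is [c], and [-(N+1) <= a < c] gives [-N <= c]. *)
  apply: IH.
    by rewrite map_inj_uniq ?filter_uniq//; exact: (can_inj (flipK R)).
  move=> _ /mapP[t + ->]; rewrite mem_filter => /andP[/andP[c0 ac] /hr[ht aN]].
  split; first exact: Hindex_flip.
  by move: ac aN; rewrite /flip /=; move: (t.1.1) (t.2) => a c; lia.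
by lra.
Qed.

Lemma esum_Hterm_le (z : R[i]) :
  (\esum_(t in hindex) (Hterm R k t z)%:E <= Hbound%:E)%E.
Proof.
apply: ge_ereal_sup => _ [X [finX XI] <-].
rewrite fsbig_finite//= sumEFin lee_fin.
(* [Hbound] does not depend on [N], so each finite subset may use its own maximum of [|a|]. *)
apply: (@Hterm_sum_le (\max_(t <- fset_set X) absz t.1.1)).
  exact: fset_uniq.
move=> t tX; have ht : hindex t by apply/XI/set_mem; rewrite -in_fset_set.
split=> //.
have : (absz t.1.1 <= \max_(t <- fset_set X) absz t.1.1)%N.
  by rewrite (big_rem t tX) /= leq_maxl.
by move: (t.1.1) => a; lia.
Qed.

Lemma summable_Hterm (z : R[i]) :
  summable hindex (fun t => (Hterm R k t z)%:E).
Proof.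
apply: le_lt_trans (ltry Hbound).
rewrite (eq_esum (b := fun t => (Hterm R k t z)%:E)) ?esum_Hterm_le// => t _.
by rewrite gee0_abs// lee_fin Hterm_ge0.
Qed.

(** * Splitting by the sign of [c], and the functional equations *)

Definition posc : set (int * R[i] * int) := [set t | 0 < t.2].
Definition Hpos (z : R[i]) : R :=
  fine (\esum_(t in hindex `&` posc) (Hterm R k t z)%:E)%E.
Definition Hneg (z : R[i]) : R :=
  fine (\esum_(t in hindex `&` ~` posc) (Hterm R k t z)%:E)%E.

Lemma esum_sub_le (A : set (int * R[i] * int)) (z : R[i]) : A `<=` hindex ->
  (0 <= \esum_(t in A) (Hterm R k t z)%:E <= Hbound%:E)%E.
Proof.
move=> sA; apply/andP; split.
  by apply: esum_ge0 => t _; rewrite lee_fin Hterm_ge0.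
apply: le_trans (esum_Hterm_le z); apply: le_ereal_sup => _ [X [finX XA] <-].
by exists X => //; split=> //; exact: subset_trans XA sA.
Qed.

Lemma esum_sub_fin_num (A : set (int * R[i] * int)) (z : R[i]) :
  A `<=` hindex -> (\esum_(t in A) (Hterm R k t z)%:E \is a fin_num)%E.
Proof.
move=> /esum_sub_le-/(_ z)/andP[h0 h1].
by rewrite ge0_fin_numE// (le_lt_trans h1)// ltry.
Qed.

Lemma fine_esum_sub_le (A : set (int * R[i] * int)) (z : R[i]) : A `<=` hindex ->
  0 <= fine (\esum_(t in A) (Hterm R k t z)%:E)%E <= Hbound.
Proof.
move=> sA; have := esum_sub_le A z sA.
by rewrite -{1 2}[(\esum_(t in A) _)%E]fineK ?esum_sub_fin_num// !lee_fin.
Qed.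

Lemma H_split z : H R d Delta k z = Hpos z + Hneg z.
Proof.
rewrite /H /Hpos /Hneg -fineD ?esum_sub_fin_num//.
by rewrite -esumID// => t _; rewrite lee_fin Hterm_ge0.
Qed.

Lemma negcP t : (hindex `&` ~` posc) t <-> hindex t /\ t.2 < 0.
Proof.
split=> -[ht hc]; split=> //.
  by have := Hindex_c_neq0 not_norm _ ht; move/negP: hc; rewrite -leNgt lt_neqAle => -> ->.
by apply/negP; rewrite -leNgt ltW.
Qed.

(** [flip] is an involution of the forms with [a] and [c] both negative. The origin is included:
    both sides vanish there. *)
Lemma Hneg_flip z : Hneg z = sqmod R z ^+ k * Hneg (cinv R z).
Proof.
have sK0 : 0 <= sqmod R z ^+ k by rewrite exprn_ge0// sqmod_ge0.
have flip_neg t : (hindex `&` ~` posc) t -> (hindex `&` ~` posc) (flip R t).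
  move=> /negcP[ht c0]; apply/negcP; split; first exact: Hindex_flip.
  by case: t ht {c0} => [[a b] c] /HindexE[].
have flip_bij : set_bij (hindex `&` ~` posc) (hindex `&` ~` posc) (flip R).
  split=> [t /flip_neg//|t t' _ _|t ht]; first exact: (can_inj (flipK R)).
  by exists (flip R t); [exact: flip_neg|exact: flipK].
have E := reindex_esum _ _ _ (fun t => (Hterm R k t (cinv R z))%:E) flip_bij.
rewrite /Hneg E -[X in X * _]/(fine (sqmod R z ^+ k)%:E) -fineM//; last first.
  by rewrite -E esum_sub_fin_num.
rewrite -esum_pZl//; last by move=> t; rewrite lee_fin Hterm_ge0.
by congr fine; apply: eq_esum => t /negcP[ht c0]; rewrite -EFinM Hterm_flip.
Qed.

(** [translate] by [mu] permutes the family, with inverse [translate] by [- mu]. *)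
Lemma H_translate mu z : Od R d mu ->
  H R d Delta k (z + conjc mu) = H R d Delta k z.
Proof.
move=> hmu; rewrite /H.
have hNmu : Od R d (- mu).
  case: hmu => m [n ->]; exists (- m), (- n).
  by rewrite !intrN opprD mulNr.
rewrite [in RHS](reindex_esum hindex _ (translate R mu)).
  by congr fine; apply: eq_esum => t ht; rewrite /Hterm Qform_translate.
split.
- by move=> t ht; exact: Hindex_translate.
- move=> t t' /set_mem ht /set_mem ht' E.
  by rewrite -(translate_opp _ _ ht hmu) E translate_opp.
- move=> t ht; exists (translate R (- mu) t); first exact: Hindex_translate.
  by rewrite -[in X in translate _ X](opprK mu) translate_opp.
Qed.

Lemma finite_posc : finite_set (hindex `&` posc).
Proof.
by apply: sub_finite_set finite_box => t []; exact: Hindex_pos_box.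
Qed.

Lemma continuous_Hpos : continuous (Hpos \o plane R).
Proof.
have -> : Hpos \o plane R = fun p =>
    \sum_(t <- fset_set (hindex `&` posc)) (Hterm R k t \o plane R) p.
  apply/funext => p; rewrite /= /Hpos esum_fset; first last.
  - by move=> t _; rewrite lee_fin Hterm_ge0.
  - exact: finite_posc.
  by rewrite fsbig_finite/= ?sumEFin//; exact: finite_posc.
apply: continuous_big; last by move=> t _; exact: continuous_Hterm.
exact: add_continuous.
Qed.

(** * Contraction of the oscillation and continuity *)

Let F (p : R * R) : R := H R d Delta k (plane R p).

(** [eta] is uniform in [p], since the contraction compares the oscillation at [p] with that at
    another point. *)
Definition osc_le (eta : R) :=
  forall p, \forall q \near p, `|F q - F p| <= eta.

Lemma Hneg_bound z : 0 <= Hneg z <= Hbound.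
Proof. by apply: fine_esum_sub_le => t []. Qed.

Lemma osc_le_bound : osc_le Hbound.
Proof.
move=> p; near=> q.
have /andP[a0 a1] : 0 <= F q <= Hbound by apply: fine_esum_sub_le.
have /andP[b0 b1] : 0 <= F p <= Hbound by apply: fine_esum_sub_le.
by rewrite ler_norml; lra.
Unshelve. all: by end_near. Qed.

(** With [x = sqmod ^ k], the increment of [F] is that of [Hpos], plus [(x q - x p) Hneg (inv q)],
    plus [x p] times the increment of [Hneg] between the inverted points. The first two are at most
    [e / 4] each; the last is at most [(15/16) (eta + e / 4)]. *)
Lemma osc_le_reduced (eta e : R) p : osc_le eta -> 0 <= eta -> 0 < e ->
  sqmod R (plane R p) <= 15 / 16 ->
  \forall q \near p, `|F q - F p| <= 15 / 16 * eta + e.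
Proof.
move=> hosc eta0 e0 hp.
have M0 := Hbound_ge0.
pose inv (q : R * R) :=
  (q.1 / sqmod R (plane R q), q.2 / sqmod R (plane R q)).
have HnegE q : Hneg (plane R q) = sqmod R (plane R q) ^+ k * Hneg (plane R (inv q)).
  exact: Hneg_flip.
have near_pos : \forall q \near p, `|Hpos (plane R p) - Hpos (plane R q)| <= e / 4.
  have /cvgrPdist_le := continuous_Hpos p; apply; lra.
have near_sq : \forall q \near p,
    `|sqmod R (plane R p) ^+ k - sqmod R (plane R q) ^+ k| <= e / 4 / (Hbound + 1).
  have : (fun q => sqmod R (plane R q) ^+ k) @ p --> sqmod R (plane R p) ^+ k.
    apply: (@continuous_comp _ _ _ (sqmod R \o plane R) (fun x => x ^+ k)).
      exact: continuous_sqmod.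
    exact: exprn_continuous.
  by move/cvgrPdist_le; apply; rewrite divr_gt0//; lra.
have near_inv : \forall q \near p, sqmod R (plane R p) ^+ k *
    `|Hneg (plane R (inv q)) - Hneg (plane R (inv p))| <= 15 / 16 * (eta + e / 4).
  (* Inversion is not continuous at the origin, but there the factor in front vanishes, as
     [k >= 1]. *)
  have [p0|p0] := eqVneq (sqmod R (plane R p)) 0.
    near=> q; rewrite p0 expr0n; case: k hk => //= _ _; rewrite mul0r; lra.
  have c1 := continuous_cinv R p p0 _ (hosc (inv p)).
  have c2 : \forall q \near p,
      `|Hpos (plane R (inv p)) - Hpos (plane R (inv q))| <= e / 4.
    have : Hpos \o plane R \o inv @ p --> Hpos (plane R (inv p)).
      apply: (@continuous_comp _ _ _ inv (Hpos \o plane R)).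
        exact: continuous_cinv.
      exact: continuous_Hpos.
    by move/cvgrPdist_le; apply; lra.
  near=> q.
  apply: ler_pM => //; first by rewrite exprn_ge0// sqmod_ge0.
    by rewrite exprn_contract// sqmod_ge0.
  have h1 : `|F (inv q) - F (inv p)| <= eta by near: q.
  have h2 : `|Hpos (plane R (inv p)) - Hpos (plane R (inv q))| <= e / 4 by near: q.
  (* [Hneg = F - Hpos] costs [eta] for [F] and [e / 4] for [Hpos]. *)
  move: h1 h2; rewrite /F !H_split !ler_norml; lra.
near=> q.
have h1 : `|Hpos (plane R p) - Hpos (plane R q)| <= e / 4 by near: q.
have h2 : `|sqmod R (plane R p) ^+ k - sqmod R (plane R q) ^+ k|
  <= e / 4 / (Hbound + 1) by near: q.
have h3 : sqmod R (plane R p) ^+ k *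
    `|Hneg (plane R (inv q)) - Hneg (plane R (inv p))| <= 15 / 16 * (eta + e / 4).
  by near: q.
have /andP[n0 n1] := Hneg_bound (plane R (inv q)).
have h4 : `|(sqmod R (plane R q) ^+ k - sqmod R (plane R p) ^+ k) *
    Hneg (plane R (inv q))| <= e / 4.
  rewrite normrM distrC (ger0_norm n0).
  apply: (@le_trans _ _ (e / 4 / (Hbound + 1) * (Hbound + 1))).
    by apply: ler_pM => //; lra.
  by rewrite divfK//; apply/eqP; lra.
have h5 : `|sqmod R (plane R p) ^+ k *
    (Hneg (plane R (inv q)) - Hneg (plane R (inv p)))| <= 15 / 16 * (eta + e / 4).
  by rewrite normrM ger0_norm// exprn_ge0// sqmod_ge0.
rewrite /F !H_split HnegE (HnegE p).
move: h1 h4 h5; rewrite !ler_norml.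
move: (sqmod R (plane R q) ^+ k) (sqmod R (plane R p) ^+ k) => x y.
move: (Hneg _) (Hneg _) (Hpos _) (Hpos _) => u v w t.
rewrite mulrBl mulrBr; lra.
Unshelve. all: by end_near. Qed.

(** By periodicity the oscillation at [p] equals that at a translate of [p] in the disc. *)
Lemma osc_le_contract (eta e : R) :
  osc_le eta -> 0 <= eta -> 0 < e -> osc_le (15 / 16 * eta + e).
Proof.
move=> hosc eta0 e0 p.
have [mu hmu [z hz pz]] := reduce_point (plane R p).
pose tau (q : R * R) := (q.1 - complex.Re mu, q.2 + complex.Im mu).
have tauE q : plane R q = plane R (tau q) + conjc mu.
  by rewrite /tau; case: mu {hmu pz tau} => u v; congr Complex => /=; ring.
have Ftau q : F (tau q) = F q by rewrite {2}/F tauE H_translate.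
have tau_cts : {for p, continuous tau}.
  have h1 : (fun q : R * R => q.1 - complex.Re mu) @ p --> p.1 - complex.Re mu.
    by apply: cvgB; [exact: cvg_fst|exact: cvg_cst].
  have h2 : (fun q : R * R => q.2 + complex.Im mu) @ p --> p.2 + complex.Im mu.
    by apply: cvgD; [exact: cvg_snd|exact: cvg_cst].
  exact: cvg_pair h1 h2.
have hp : sqmod R (plane R (tau p)) <= 15 / 16.
  suff -> : plane R (tau p) = z by [].
  by apply: (addIr (conjc mu)); rewrite -tauE.
have near_tau : \forall q \near p,
    `|F (tau q) - F (tau p)| <= 15 / 16 * eta + e.
  exact: tau_cts _ (osc_le_reduced eta e (tau p) hosc eta0 e0 hp).
by apply: filterS near_tau => q; rewrite !Ftau.
Qed.

(** Contraction with [e = x / 32], as [15/16 + 1/32 = 31/32]; the [+ 1] keeps [x], and so [e],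
    positive even if [Hbound] is zero. *)
Lemma osc_le_geometric n : osc_le ((Hbound + 1) * (31 / 32) ^+ n).
Proof.
have M0 := Hbound_ge0.
elim: n => [|n IH].
  by move=> p; apply: filterS (osc_le_bound p) => q; rewrite expr0; lra.
set x := (_ * _) in IH; have x0 : 0 < x by rewrite mulr_gt0 ?exprn_gt0//; lra.
have -> : (Hbound + 1) * (31 / 32) ^+ n.+1 = 15 / 16 * x + x / 32.
  by rewrite /x exprS; field.
by apply: osc_le_contract => //; lra.
Qed.

Lemma continuous_H : continuous F.
Proof.
move=> p; apply/cvgrPdist_le => e e0.
have : geometric (Hbound + 1) (31 / 32) @ \oo --> (0 : R).
  by apply: cvg_geometric; rewrite ger0_norm; lra.
move=> /cvgrPdist_le /(_ _ e0)[n _ /(_ n (leqnn n))] /=.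
rewrite sub0r normrN => /(le_trans (ler_norm _)) hn.
apply: filterS (osc_le_geometric n p) => q hq.
by rewrite distrC (le_trans hq).
Qed.

End Family.

Theorem theorem1p3 (R : realType) (d : nat) (hd : d \in [:: 1; 2; 3; 7; 11]%N)
  (Delta : nat) (hDelta : (0 < Delta)%N)
  (hnorm : ~ exists beta : R[i], Od R d beta /\ beta * conjc beta = Delta%:R)
  (k : nat) (hk : odd k) :
  (forall z : R[i], summable (Hindex R d Delta) (fun t => (Hterm R k t z)%:E))
  /\ continuous (fun p : (R * R)%type => H R d Delta k (Complex p.1 p.2)).
Proof.
have [T [q [s [omegaE omega_norm s_gt0 s_le]]]] := omega_dP R d hd.
split=> [z|].
  exact: (summable_Hterm omegaE omega_norm s_gt0 s_le hk hnorm).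
exact: (continuous_H omegaE omega_norm s_gt0 s_le hk hnorm).
Qed.
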